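(* Let $\varphi$ be a computable forecasting system. Then a path $\omega\in\Omega$ is Martin-Löf test random for $\varphi$ if and only if it is uniformly random for the class of probability measures $\mathcal M_\varphi=\{\mu_{\psi}:\psi\text{ precise forecasting system with }\psi(s)\in\varphi(s)\text{ for all }s\in\mathbb S\}$.
   Context: Notation: $\mathbb N_0=\{0,1,2,\dots\}$; $\Omega=\{0,1\}^{\mathbb N}$ with the Cantor topology and Borel $\sigma$-algebra; $\mathbb S=\bigcup_{n}\{0,1\}^n$ finite binary strings, $\square$ the empty string, $|s|$ length, $s^k$ the prefix of length $k$ and $s_{k}$ the $k$-th entry of $s$, $\omega^n$ the first $n$ entries of $\omega$. $[s]=\{\omega:\omega^{|s|}=s\}$, $[A]=\bigcup_{s\in A}[s]$; for $A\subseteq\mathbb N_0\times\mathbb S$, $A_n=\{s:(n,s)\in A\}$, and for $B\subseteq\mathbb Q\times\mathbb S$, $B_r=\{s:(r,s)\in B\}$. $\mathcal I$: nonempty closed subintervals of $[0,1]$; $\overline E_I(f)=\max_{p\in I}[pf(1)+(1-p)f(0)]$. A forecasting system is $\varphi:\mathbb S\to\mathcal I$, $\underline\varphi=\min\varphi$, $\overline\varphi=\max\varphi$; precise if $\underline\varphi=\overline\varphi$ (identified with a map $\mathbb S\to[0,1]$). Supermartingale for $\varphi$: $M:\mathbb S\to\mathbb R$ with $\overline E_{\varphi(s)}(M(s\,\cdot))\le M(s)$ for all $s$. $\overline P_\varphi(G)=\inf\{M(\square):M\text{ supermartingale for }\varphi,\ \liminf_nM(\omega^n)\ge\mathbb 1_G(\omega)\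 \forall\omega\}$. Computability: recursive maps, recursive/recursively enumerable sets as usual; a real map $r$ on a countable encoded set is computable if there is a recursive rational $q$ with $|r(d)-q(d,N)|\le2^{-N}$; $\varphi$ is computable if $\underline\varphi,\overline\varphi$ are computable. A Martin-Löf test for $\varphi$ is a recursively enumerable $A\subseteq\mathbb N_0\times\mathbb S$ with $\overline P_\varphi([A_n])\le2^{-n}$ for all $n$; $\omega$ is Martin-Löf test random for $\varphi$ if $\omega\notin\bigcap_n[A_n]$ for every such $A$. For a precise forecasting system $\psi$, $\mu_\psi$ is the unique Borel probability measure on $\Omega$ with $\mu_\psi([s])=\prod_{k=0}^{|s|-1}\psi(s^k)^{s_{k+1}}(1-\psi(s^k))^{1-s_{k+1}}$ for all $s$. For a class $\mathcal C$ of Borel probability measures on $\Omega$, a $\mathcal C$-test is a map $\tau:\Omega\to[0,\infty]$ such that there is a recursively enumerable $B\subseteq\mathbb Q\times\mathbb S$ with $\{\omega:\tau(\omega)>r\}=[B_r]$ for all $r\in\mathbb Q$, and $\int\tau\,d\mu\le1$ for all $\mu\in\mathcal C$. A path $\omega$ is uniformly random for $\mathcal C$ if $\tau(\omega)<\infty$ for every $\mathcal C$-test $\tau$. *)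

(* Defs.v *)
From HB Require Import structures.
From mathcomp Require Import all_boot all_order all_algebra.
From mathcomp Require Import all_classical all_reals all_analysis.
Set Implicit Arguments. Unset Strict Implicit. Unset Printing Implicit Defensive.
Import Order.TTheory GRing.Theory Num.Theory.
Local Open Scope classical_set_scope.
Local Open Scope ring_scope.

Inductive code : Type :=
| CZero
| CSucc
| CProj of nat
| CComp of code & list code
| CRec of code & code
| CMu of code.

Inductive eval : code -> list nat -> nat -> Prop :=
| ev_zero xs : eval CZero xs 0
| ev_succ xs : eval CSucc xs (head 0%N xs).+1
| ev_proj i xs : eval (CProj i) xs (nth 0%N xs i)
| ev_comp f gs xs ys y :
    evals gs xs ys -> eval f ys y -> eval (CComp f gs) xs y
| ev_rec0 f g xs y : eval f xs y -> eval (CRec f g) (0%N :: xs) y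
| ev_recS f g n xs z y :
    eval (CRec f g) (n :: xs) z -> eval g (n :: z :: xs) y ->
    eval (CRec f g) (n.+1 :: xs) y
| ev_mu f xs n :
    eval f (n :: xs) 0%N ->
    (forall m, (m < n)%N -> exists k, eval f (m :: xs) k.+1) ->
    eval (CMu f) xs n
with evals : list code -> list nat -> list nat -> Prop :=
| evs_nil xs : evals [::] xs [::]
| evs_cons g gs xs y ys :
    eval g xs y -> evals gs xs ys -> evals (g :: gs) xs (y :: ys).

Definition recursive2 (f : nat -> nat -> nat) : Prop :=
  exists c, forall x y, eval c [:: x; y] (f x y).

Definition re_pred2 (P : nat -> nat -> Prop) : Prop :=
  exists c, forall x y, P x y <-> exists v, eval c [:: x; y] v.
Definition re_pred4 (P : nat -> nat -> nat -> nat -> Prop) : Prop :=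
  exists c, forall a b d x, P a b d x <-> exists v, eval c [:: a; b; d; x] v.

(* bijective encoding of finite binary strings into nat *)
Fixpoint code_str (s : seq bool) : nat :=
  match s with
  | [::] => 0%N
  | b :: s' => ((code_str s').*2 + 1 + b)%N
  end.

Definition Omega : Type := g_sigma_algebraType (@open cantor_space).

Definition prefix (n : nat) (w : Omega) : seq bool := mkseq w n.

Definition cyl (s : seq bool) : set Omega := [set w | prefix (size s) w = s].

Definition cyls (A : seq bool -> Prop) : set Omega :=
  [set w | exists s, A s /\ prefix (size s) w = s].

Definition re_setN (A : nat -> seq bool -> Prop) : Prop :=
  exists P, re_pred2 P /\ forall n s, A n s <-> P n (code_str s).

Definition rat_of (a b d : nat) : rat := (a%:Q - b%:Q) / (d.+1)%:Q.

Definition re_setQ (B : rat -> seq bool -> Prop) : Prop :=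
  exists P, re_pred4 P /\ forall a b d s, B (rat_of a b d) s <-> P a b d (code_str s).

Section Reals.
Variable R : realType.

Definition computable_real_map (r : seq bool -> R) : Prop :=
  exists fa fb fd : nat -> nat -> nat,
    [/\ recursive2 fa, recursive2 fb, recursive2 fd &
      forall s N, `| r s - ratr (rat_of (fa (code_str s) N) (fb (code_str s) N)
                                        (fd (code_str s) N)) | <= 2%:R ^- N].

Record forecasting_system := FS {
  flo : seq bool -> R;
  fhi : seq bool -> R;
  fs_interval : forall s, 0 <= flo s /\ flo s <= fhi s /\ fhi s <= 1 }.

Definition computable_fs (phi : forecasting_system) : Prop :=
  computable_real_map (flo phi) /\ computable_real_map (fhi phi).

(* upper expectation over I = [a, b] of the gamble f with f(1) = f1, f(0) = f0 *)
Definition upper_exp (a b f1 f0 : R) : R :=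
  sup [set p * f1 + (1 - p) * f0 | p in `[a, b]].

Definition supermartingale (phi : forecasting_system) (M : seq bool -> R) : Prop :=
  forall s, upper_exp (flo phi s) (fhi phi s) (M (rcons s true)) (M (rcons s false)) <= M s.

Definition upper_prob (phi : forecasting_system) (G : set Omega) : \bar R :=
  ereal_inf [set (M [::])%:E | M in
    [set M | supermartingale phi M /\
       forall w, ((\1_G w : R)%:E <= limn_einf (fun n => (M (prefix n w))%:E))%E]].

Definition ML_test (phi : forecasting_system) (A : nat -> seq bool -> Prop) : Prop :=
  re_setN A /\ forall n, (upper_prob phi (cyls (A n)) <= (2%:R ^- n : R)%:E)%E.

Definition ML_random (phi : forecasting_system) (w : Omega) : Prop :=
  forall A, ML_test phi A -> ~ (forall n, cyls (A n) w).

Definition cyl_prob (psi : seq bool -> R) (s : seq bool) : R :=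
  \prod_(k < size s) (if nth false s k then psi (take k s) else 1 - psi (take k s)).

Definition M_class (phi : forecasting_system) : set (probability Omega R) :=
  [set mu | exists psi : seq bool -> R,
     (forall s, flo phi s <= psi s <= fhi phi s) /\
     forall s, mu (cyl s) = (cyl_prob psi s)%:E].

Definition unif_test (C : set (probability Omega R)) (tau : Omega -> \bar R) : Prop :=
  (forall w, (0 <= tau w)%E) /\
  (exists B, re_setQ B /\ forall (r : rat) w, ((ratr r)%:E < tau w)%E <-> cyls (B r) w) /\
  (forall mu, C mu -> (\int[mu]_w tau w <= 1)%E).

Definition unif_random (C : set (probability Omega R)) (w : Omega) : Prop :=
  forall tau, unif_test C tau -> (tau w < +oo)%E.

End Reals.

(* Main.v *)
Require Import Defs.
From HB Require Import structures.
From mathcomp Require Import all_boot all_order all_algebra.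
From mathcomp Require Import all_classical all_reals all_analysis.
From mathcomp Require Import measurable_realfun zify lra.

(** For open sets [G] the upper probability is the supremum of [mu G] over
    [mu] in [M_class phi].  A supermartingale whose lower limit dominates the
    indicator of [G] is nonnegative, and at least [1] at every string that
    already forces membership in [G], so its initial value bounds [mu G].
    Conversely, backward induction gives the largest probability of entering
    [G] within [m] steps; it is attained by a precise selection from [phi],
    and its limit in [m] is a supermartingale that is [1] on [G] eventually.

    A uniform test [tau] then yields the Martin-Löf test [{tau > 2^n}] by
    Markov's inequality.  A Martin-Löf test [A] yields the uniform test
    [sup {n | n = 0 or w in [A_(2n+1)]}], whose integral is at most
    [sum_n n 2^-(2n+1) <= 1]; its superlevel sets are recursively enumerable
    because halting can be searched by a total recursive step function. *)

Set Implicit Arguments. Unset Strict Implicit. Unset Printing Implicit Defensive.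

(** * Recursive functions and step functions *)

Local Notation code := Defs.code.
Local Notation eval := Defs.eval.

(** Computes to a plain conjunction, so that a goal about a concrete list splits entry by entry. *)
Definition all_prop T (Q : T -> Prop) (s : seq T) : Prop :=
  foldr (fun x P => Q x /\ P) True s.

(** The codes listed inside [CComp] need induction hypotheses too; an inner induction on that list
    supplies them. *)
Lemma code_nested_ind (Q : code -> Prop) :
  Q CZero -> Q CSucc -> (forall i, Q (CProj i)) ->
  (forall f gs, Q f -> all_prop Q gs -> Q (CComp f gs)) ->
  (forall f g, Q f -> Q g -> Q (CRec f g)) ->
  (forall f, Q f -> Q (CMu f)) -> forall c, Q c.
Proof.
move=> Q0 QS QP QC QR QM; fix IH 1; case=> [||i|f gs|f g|f].
- exact: Q0.
- exact: QS.
- exact: QP.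
- apply: QC; first exact: IH.
  by elim: gs => [|g gs IHgs]; [exact: I | split; [exact: IH | exact: IHgs]].
- by apply: QR; exact: IH.
- by apply: QM; exact: IH.
Qed.

Lemma evals_cons_inv g gs xs vs : evals (g :: gs) xs vs ->
  exists v vs', [/\ vs = v :: vs', eval g xs v & evals gs xs vs'].
Proof. by move=> H; inversion H; subst; exists y, ys. Qed.

Lemma eval_comp_inv f gs xs v : eval (CComp f gs) xs v ->
  exists2 vs, evals gs xs vs & eval f vs v.
Proof. by move=> H; inversion H; subst; exists ys. Qed.

Lemma eval_rec0_inv f g xs v : eval (CRec f g) (0 :: xs) v -> eval f xs v.
Proof. by move=> H; inversion H. Qed.

Lemma eval_recS_inv f g n xs v : eval (CRec f g) (n.+1 :: xs) v ->
  exists2 z, eval (CRec f g) (n :: xs) z & eval g (n :: z :: xs) v.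
Proof. by move=> H; inversion H; subst; exists z. Qed.

Lemma eval_mu_inv f xs n : eval (CMu f) xs n ->
  eval f (n :: xs) 0 /\ forall m, m < n -> exists k, eval f (m :: xs) k.+1.
Proof. by move=> H; inversion H. Qed.

(* The arity matters because [CRec] diverges on the empty list. *)
Definition recursive_on (k : nat) (F : seq nat -> nat) : Prop :=
  exists c, forall xs, size xs = k -> eval c xs (F xs).

Lemma recursive_on_ext k F G :
  (forall xs, size xs = k -> F xs = G xs) ->
  recursive_on k F -> recursive_on k G.
Proof. by move=> FG [c Hc]; exists c => xs sxs; rewrite -FG //; exact: Hc. Qed.

Lemma recursive_on_proj k i : recursive_on k (fun xs => nth 0 xs i).
Proof. by exists (CProj i) => xs _; constructor. Qed.

Lemma all_recursive_on_evals k Gs : all_prop (recursive_on k) Gs ->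
  exists gs, forall xs, size xs = k -> evals gs xs [seq G xs | G <- Gs].
Proof.
elim: Gs => [_|G Gs IH /= [[c Hc] /IH [gs Hgs]]].
  by exists [::] => xs _; constructor.
by exists (c :: gs) => xs sxs; constructor; [exact: Hc | exact: Hgs].
Qed.

Lemma recursive_on_comp k F Gs :
  recursive_on (size Gs) F -> all_prop (recursive_on k) Gs ->
  recursive_on k (fun xs => F [seq G xs | G <- Gs]).
Proof.
move=> [c Hc] /all_recursive_on_evals [gs Hgs].
exists (CComp c gs) => xs sxs; econstructor; first exact: Hgs.
by apply: Hc; rewrite size_map.
Qed.

(** The untouched arguments [drop j xs] are a list of projections, so this is an ordinary
    composition. Deleting, duplicating or permuting leading arguments are instances. *)
Lemma recursive_on_subst j k F Gs :
  recursive_on (size Gs + k) F -> all_prop (recursive_on (j + k)) Gs ->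
  recursive_on (j + k) (fun xs => F ([seq G xs | G <- Gs] ++ drop j xs)).
Proof.
move=> rF rGs.
pose projs : seq (seq nat -> nat) := [seq (fun xs => nth 0 xs i) | i <- iota j k].
apply: (@recursive_on_ext _ (fun xs => F [seq K xs | K <- Gs ++ projs])).
  move=> xs sxs; rewrite map_cat; congr (F (_ ++ _)).
  rewrite -[RHS](mkseq_nth 0) /mkseq size_drop sxs addKn -map_comp.
  rewrite -[j in iota j k]addn0 iotaDl -map_comp.
  by apply: eq_map => i /=; rewrite nth_drop.
apply: recursive_on_comp; first by rewrite size_cat size_map size_iota.
elim: Gs rGs {rF} => [_|G Gs IH /= [rG /IH rGs]]; last by split.
rewrite /projs /=; elim: (iota j k) => //= i s IH; split=> //.
exact: recursive_on_proj.
Qed.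

Lemma recursive_on_succ k G :
  recursive_on k G -> recursive_on k (fun xs => (G xs).+1).
Proof.
move=> rG; apply: (@recursive_on_comp k (fun ys => (head 0 ys).+1) [:: G]) => //.
by exists CSucc => xs _; constructor.
Qed.

Lemma recursive_on_const k n : recursive_on k (fun=> n).
Proof.
elim: n => [|n IH]; last exact: recursive_on_succ.
by exists CZero => xs _; constructor.
Qed.

Definition primrec (f g : seq nat -> nat) (n : nat) (xs : seq nat) : nat :=
  nat_rect (fun=> nat) (f xs) (fun m z => g (m :: z :: xs)) n.

Lemma primrecS f g n xs : primrec f g n.+1 xs = g [:: n, primrec f g n xs & xs].
Proof. by []. Qed.

Lemma recursive_on_primrec k f g N :
  recursive_on k f -> recursive_on k.+2 g -> recursive_on k N ->
  recursive_on k (fun xs => primrec f g (N xs) xs).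
Proof.
move=> [cf Hf] [cg Hg] rN.
(* [CRec] recurses on the head of its argument list, so the number of rounds is first made an
   argument and [N] is substituted for it afterwards. *)
pose F ys := primrec f g (head 0 ys) (behead ys).
apply: (@recursive_on_ext _ (fun xs => F ([seq G xs | G <- [:: N]] ++ drop 0 xs))).
  by move=> xs _; rewrite drop0.
apply: (@recursive_on_subst 0); last by split.
exists (CRec cf cg) => -[|n xs] //= [sxs]; rewrite /F /=.
elim: n => [|n IH]; first by constructor; exact: Hf.
by econstructor; [exact: IH | apply: Hg; rewrite /= sxs].
Qed.

Lemma recursive_on_drop2 k F :
  recursive_on k F -> recursive_on k.+2 (fun xs => F (drop 2 xs)).
Proof. by move=> rF; exact: (@recursive_on_subst 2 k F [::]). Qed.

(** A branch is a primitive recursion whose step ignores the previous value: zero rounds leave [F],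
    any positive number gives [G]. *)
Lemma recursive_on_if k B F G :
  recursive_on k B -> recursive_on k F -> recursive_on k G ->
  recursive_on k (fun xs => if B xs == 0 then F xs else G xs).
Proof.
move=> rB rF rG.
apply: recursive_on_ext (recursive_on_primrec rF (recursive_on_drop2 rG) rB).
by move=> xs _; case: (B xs) => //= m; rewrite drop0.
Qed.

Lemma recursive_on_pred k F :
  recursive_on k F -> recursive_on k (fun xs => (F xs).-1).
Proof.
move=> rF; apply: recursive_on_ext
  (recursive_on_primrec (recursive_on_const k 0) (recursive_on_proj k.+2 0) rF).
by move=> xs _; case: (F xs).
Qed.

Lemma recursive_on_add k F G :
  recursive_on k F -> recursive_on k G -> recursive_on k (fun xs => F xs + G xs).
Proof.
move=> rF rG; apply: recursive_on_ext
  (recursive_on_primrec rF (recursive_on_succ (recursive_on_proj k.+2 1)) rG).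
by move=> xs _; elim: (G xs) => [|n IH] /=; rewrite ?addn0 // addnS -IH.
Qed.

Lemma recursive_on_sub k F G :
  recursive_on k F -> recursive_on k G -> recursive_on k (fun xs => F xs - G xs).
Proof.
move=> rF rG; apply: recursive_on_ext
  (recursive_on_primrec rF (recursive_on_pred (recursive_on_proj k.+2 1)) rG).
by move=> xs _; elim: (G xs) => [|n IH] /=; rewrite ?subn0 // subnS -IH.
Qed.

Lemma recursive_on_mul k F G :
  recursive_on k F -> recursive_on k G -> recursive_on k (fun xs => F xs * G xs).
Proof.
move=> rF rG; apply: recursive_on_ext (recursive_on_primrec (recursive_on_const k 0)
  (recursive_on_add (recursive_on_drop2 rF) (recursive_on_proj k.+2 1)) rG).
by move=> xs _; elim: (G xs) => [|n IH] /=; rewrite ?muln0 // mulnS -IH drop0.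
Qed.

Lemma recursive_on_exp2 k F :
  recursive_on k F -> recursive_on k (fun xs => 2 ^ F xs).
Proof.
move=> rF; apply: recursive_on_ext (recursive_on_primrec (recursive_on_const k 1)
  (recursive_on_add (recursive_on_proj k.+2 1) (recursive_on_proj k.+2 1)) rF).
by move=> xs _; elim: (F xs) => [//|n IH]; rewrite expnS mul2n -addnn -IH.
Qed.

(* [F (t :: xs)] is [0] as long as [c] has not halted on [xs] with resources
   [t], and [v.+1] once it has halted with value [v]. *)
Definition step_function (k : nat) (c : code) (F : seq nat -> nat) : Prop :=
  [/\ recursive_on k.+1 F,
      forall xs t t' v, size xs = k -> t <= t' ->
        F (t :: xs) = v.+1 -> F (t' :: xs) = v.+1
    & forall xs v, size xs = k ->
        (eval c xs v <-> exists t, F (t :: xs) = v.+1)].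

(** One budget [t] is shared by all codes of the list; equality with [map S vs] says that every one
    of them has halted. *)
Definition step_functions (k : nat) (gs : seq code) (Fs : seq (seq nat -> nat)) :=
  [/\ all_prop (recursive_on k.+1) Fs,
      forall xs t t' vs, size xs = k -> t <= t' ->
        [seq F (t :: xs) | F <- Fs] = map S vs ->
        [seq F (t' :: xs) | F <- Fs] = map S vs
    & forall xs vs, size xs = k ->
        (evals gs xs vs <-> exists t, [seq F (t :: xs) | F <- Fs] = map S vs)].

Lemma step_functions_cons k g gs F Fs :
  step_function k g F -> step_functions k gs Fs ->
  step_functions k (g :: gs) (F :: Fs).
Proof.
move=> [rF mF sF] [rFs mFs sFs]; split=> [//|xs t t' [//|v vs] sxs tt'|xs vs sxs] /=.
  by move=> [/mF-> // /mFs->].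
split=> [H|[t]].
  have [v [vs' [-> /sF[//|t1 e1] /sFs[//|t2 e2]]]] := evals_cons_inv H.
  exists (maxn t1 t2) => /=; congr cons.
    by apply: (mF _ t1); rewrite // leq_maxl.
  by apply: (mFs _ t2); rewrite // leq_maxr.
case: vs => [//|v vs] /= [e1 e2].
by constructor; [apply/sF => //; exists t | apply/sFs => //; exists t].
Qed.

Lemma step_functionsP k gs :
  all_prop (fun g => exists F, step_function k g F) gs ->
  exists Fs, step_functions k gs Fs.
Proof.
elim: gs => [_|g gs IH /= [[F HF] /IH [Fs HFs]]].
  exists [::]; split=> // xs [|v vs] _ //=.
  - by split=> _; [exists 0 | constructor].
  - by split=> [H|[]//]; inversion H.
by exists (F :: Fs); exact: step_functions_cons.
Qed.

(** A code computing a total recursive function can be declared halted at every budget. *)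
Lemma step_function_total k c F :
  recursive_on k F ->
  (forall xs v, size xs = k -> eval c xs v <-> F xs = v) ->
  step_function k c (fun xs => (F (drop 1 xs)).+1).
Proof.
move=> rF cF; split=> [|//|xs v sxs].
  by apply: recursive_on_succ; exact: (@recursive_on_subst 1 k F [::]).
by rewrite cF //= drop0; split=> [->|[_ []]//]; exists 0.
Qed.

Lemma step_function_comp k f gs Ff Fs :
  step_function (size Fs) f Ff -> step_functions k gs Fs ->
  exists F, step_function k (CComp f gs) F.
Proof.
move=> [rf mf sf] [rgs mgs sgs].
(* The product is nonzero exactly when all inner codes have halted; [vals] then strips the halting
   marks. *)
pose halted ys := foldr (fun F b => F ys * b) 1 Fs.
pose vals ys := [seq (F ys).-1 | F <- Fs].
pose G ys := if halted ys == 0 then 0 else Ff (nth 0 ys 0 :: vals ys).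
have vals_cond ys vs : [seq F ys | F <- Fs] = map S vs ->
    halted ys != 0 /\ vals ys = vs.
  rewrite /halted /vals; elim: Fs vs {rf mf sf rgs mgs sgs halted vals G} =>
    [|F Fs IH] [|v vs] //= [-> /IH [h ->]]; split=> //.
  by rewrite muln_eq0.
have cond_vals ys : halted ys != 0 -> [seq F ys | F <- Fs] = map S (vals ys).
  rewrite /halted /vals; elim: Fs {rf mf sf rgs mgs sgs halted vals G vals_cond} =>
    [|F Fs IH] //=.
  by rewrite muln_eq0 negb_or => /andP[/negbTE e /IH ->]; case: (F ys) e.
have GP t xs v : G (t :: xs) = v.+1 <->
    exists2 vs, [seq F (t :: xs) | F <- Fs] = map S vs & Ff (t :: vs) = v.+1.
  rewrite /G; split=> [|[vs /vals_cond[/negbTE-> ->] //]].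
  by case: eqP => // /eqP /cond_vals e /= ?; exists (vals (t :: xs)).
exists G; split=> [|xs t t' v sxs tt' /GP[vs e1 e2]|xs v sxs].
- apply: recursive_on_if; last 1 first.
  + pose Gs : seq (seq nat -> nat) :=
      (fun ys => nth 0 ys 0) :: [seq (fun ys => (F ys).-1) | F <- Fs].
    apply: (@recursive_on_ext _ (fun ys => Ff [seq K ys | K <- Gs])).
      by move=> ys _; rewrite /Gs /= -map_comp.
    apply: recursive_on_comp; first by rewrite /= size_map.
    split; first exact: recursive_on_proj.
    elim: Fs rgs {rf mf sf mgs sgs halted vals G vals_cond cond_vals GP Gs} =>
      [//|F Fs IH] /= [rF rFs].
    by split; [exact: recursive_on_pred | exact: IH].
  + rewrite /halted; elim: Fs rgs {rf mf sf mgs sgs halted vals G vals_cond cond_vals GP} =>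
      [_|F Fs IH /= [rF rFs]]; first exact: recursive_on_const.
    by apply: recursive_on_mul => //; exact: IH.
  + exact: recursive_on_const.
- apply/GP; exists vs; first exact: (mgs xs t).
  by apply: (mf _ t) => //; rewrite -(size_map S) -e1 size_map.
- split=> [H|[t /GP[vs e1 e2]]].
    have [ys /sgs[//|t1 e1]] := eval_comp_inv H.
    have sys : size ys = size Fs by rewrite -(size_map S) -e1 size_map.
    move=> /(sf _ _ sys)[t2 e2].
    exists (maxn t1 t2); apply/GP; exists ys.
      by apply: (mgs _ t1); rewrite // leq_maxl.
    by apply: (mf _ t2); rewrite // leq_maxr.
  econstructor; first by apply/sgs => //; exists t; exact: e1.
  by apply/sf; [rewrite -(size_map S) -e1 size_map | exists t].
Qed.

Lemma step_function_rec k f g Ff Fg :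
  step_function k f Ff -> step_function k.+2 g Fg ->
  exists F, step_function k.+1 (CRec f g) F.
Proof.
move=> [rf mf sf] [rg mg sg].
(* [f'] sees the budget, the recursion argument and the parameters; [g'] sees the counter and the
   previous marked value in front of these. A previous value [0] means not yet halted and is
   propagated. *)
pose f' ys := Ff ([seq K ys | K <- [:: nth 0 ^~ 0]] ++ drop 2 ys).
pose g' ys := if nth 0 ys 1 == 0 then 0 else
  Fg ([seq K ys | K <- [:: nth 0 ^~ 2; nth 0 ^~ 0; fun ys => (nth 0 ys 1).-1]] ++ drop 4 ys).
pose F ys := primrec f' g' (nth 0 ys 1) ys.
have F0 t xs : F [:: t, 0 & xs] = Ff (t :: xs) by rewrite /F /= /f' /= drop0.
(* Both [f'] and [g'] drop the stored recursion argument, so only the number of rounds matters. *)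
have irr t n m xs : primrec f' g' n [:: t, m & xs] = F [:: t, n & xs].
  rewrite /F /=; elim: n => [//|n IH].
  by rewrite !primrecS IH /g' /= !drop0.
have FS t n xs v : F [:: t, n.+1 & xs] = v.+1 <->
    exists2 z, F [:: t, n & xs] = z.+1 & Fg [:: t, n, z & xs] = v.+1.
  rewrite {1}/F primrecS irr /g' /= drop0.
  case: (F _) => [|z] /=; first by split=> // -[].
  by split=> [e|[z' [<-]]//]; exists z.
have mono n xs t t' v : size xs = k -> t <= t' ->
    F [:: t, n & xs] = v.+1 -> F [:: t', n & xs] = v.+1.
  move=> sxs tt'; elim: n v => [v|n IH v]; first by rewrite !F0; exact: mf.
  move=> /FS[z /IH e1 e2]; apply/FS; exists z => //.
  by apply: mg e2; rewrite //= sxs.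
exists F; split=> [|[|n xs] t t' v [sxs] // tt'|[|n xs] v [sxs] //]; last 1 first.
- elim: n v => [v|n IH v].
    split=> [H|[t]]; last by rewrite F0 => e; constructor; apply/sf => //; exists t.
    by have /sf[//|t e] := eval_rec0_inv H; exists t; rewrite F0.
  split=> [H|[t /FS[z e1 e2]]].
    have [z /IH[t1 e1] /sg[|t2 e2]] := eval_recS_inv H; first by rewrite /= sxs.
    exists (maxn t1 t2); apply/FS; exists z.
      by apply: (mono _ _ t1); rewrite // leq_maxl.
    by apply: (mg _ t2); rewrite ?leq_maxr //= sxs.
  econstructor; first by apply/IH; exists t; exact: e1.
  by apply/sg; [rewrite /= sxs | exists t].
- apply: recursive_on_primrec.
  + by apply: (@recursive_on_subst 2 k) => //; split=> //; exact: recursive_on_proj.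
  + apply: recursive_on_if; [exact: recursive_on_proj|exact: recursive_on_const|].
    apply: (@recursive_on_subst 4 k) => //; split; first exact: recursive_on_proj.
    split; first exact: recursive_on_proj.
    by split=> //; apply: recursive_on_pred; exact: recursive_on_proj.
  + exact: recursive_on_proj.
- exact: mono.
Qed.

Lemma step_function_mu k f Ff :
  step_function k.+1 f Ff -> exists F, step_function k (CMu f) F.
Proof.
move=> [rf mf sf].
(* State of the search: [0] while running, [1] if stuck, [v.+2] once [v] is found. *)
pose test ys := Ff ([seq K ys | K <- [:: nth 0 ^~ 2; nth 0 ^~ 0]] ++ drop 3 ys).
pose g' ys := if nth 0 ys 1 == 0 then
    if test ys == 0 then 1 else if (test ys).-1 == 0 then (nth 0 ys 0).+2 else 0
  else nth 0 ys 1.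
pose st m ys := primrec (fun=> 0) g' m ys.
(* The budget bounds both the candidates tried and the time spent on each. The predecessor sends
   both unsuccessful states to [0] and [v.+2] to the halting mark [v.+1]. *)
pose F ys := (st (nth 0 ys 0) ys).-1.
have stS m t xs : st m.+1 (t :: xs) = if st m (t :: xs) == 0 then
    if Ff [:: t, m & xs] == 0 then 1 else if (Ff [:: t, m & xs]).-1 == 0 then m.+2 else 0
    else st m (t :: xs).
  by rewrite {1}/st primrecS -/(st m (t :: xs)) {1}/g' /test /= drop0.
(* A value of [Ff] above [1] means that [f] has halted with a positive result, so the search moves
   on. *)
have st0 m t xs : st m (t :: xs) = 0 <-> (forall i, i < m -> 1 < Ff [:: t, i & xs]).
  elim: m => [|m IH]; first by split.
  rewrite stS; split.
    case: eqP => // /IH H; case e : (Ff _) => [//|[//|u]] /= _ i.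
    by rewrite ltnS leq_eqVlt => /orP[/eqP->|/H//]; rewrite e.
  move=> H; have /IH -> : forall i, i < m -> 1 < Ff [:: t, i & xs].
    by move=> i im; apply: H; lia.
  by have := H m (ltnSn m); case: (Ff _) => [|[|?]].
have stP m t xs v : st m (t :: xs) = v.+2 <->
    [/\ v < m, Ff [:: t, v & xs] = 1 & forall i, i < v -> 1 < Ff [:: t, i & xs]].
  elim: m => [|m IH]; first by split=> // -[].
  rewrite stS; case: eqP => [/[dup] e /st0 H|ne].
    split.
      case e' : (Ff _) => [//|[|//]] /= [<-]; split=> //; lia.
    move=> [vm e1 _]; have [vm'|] := ltnP v m.
      by have := H v vm'; rewrite e1.
    by move=> ?; have -> : m = v by [lia|]; rewrite e1.
  rewrite IH; split=> [[]|[vm e1 e2]]; first by split=> //; lia.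
  split=> //; have [//|mv] := ltnP v m; case: ne; apply/st0 => i im.
  by apply: e2; lia.
have FP t xs v : F (t :: xs) = v.+1 <->
    [/\ v < t, Ff [:: t, v & xs] = 1 & forall i, i < v -> 1 < Ff [:: t, i & xs]].
  rewrite -stP /F /=; case: (st _ _) => [|[|u]] /=; split=> //; first by case=> ->.
  by case=> ->.
exists F; split=> [|xs t t' v sxs tt' /FP[vt e1 e2]|xs v sxs].
- apply: recursive_on_pred; apply: recursive_on_primrec; last exact: recursive_on_proj.
    exact: recursive_on_const.
  have rt : recursive_on k.+3 test.
    apply: (@recursive_on_subst 3 k) => //; split; first exact: recursive_on_proj.
    by split=> //; exact: recursive_on_proj.
  apply: recursive_on_if; [exact: recursive_on_proj| |exact: recursive_on_proj].
  apply: recursive_on_if => //; first exact: recursive_on_const.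
  apply: recursive_on_if; [exact: recursive_on_pred| |exact: recursive_on_const].
  by do 2 apply: recursive_on_succ; exact: recursive_on_proj.
- apply/FP; split; [lia|by apply: mf e1; rewrite //= sxs|move=> i /e2].
  case e : (Ff _) => [//|[//|u]] _.
  by rewrite (mf _ t t' u.+1) //= sxs.
- split=> [H|[t /FP[vt e1 e2]]]; last first.
    constructor; first by apply/sf; [rewrite /= sxs | exists t].
    move=> m /e2; case e : (Ff _) => [//|[//|u]] _; exists u.
    by apply/sf; [rewrite /= sxs | exists t].
  have szS m : size (m :: xs) = k.+1 by rewrite /= sxs.
  have [/sf[//|t1 e1] H3] := eval_mu_inv H.
  (* Only finitely many candidates precede [v], so by monotonicity one budget serves them all. *)
  have [t2 e2] : exists t2, forall i, i < v -> 1 < Ff [:: t2, i & xs].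
    move: H3; elim: (v) => [_|m IH Hm]; first by exists 0.
    have [t2 H2] := IH (fun i im => Hm i (leqW im)).
    have [u /sf [//|t3 e3]] := Hm m (ltnSn m).
    exists (maxn t2 t3) => i; rewrite ltnS leq_eqVlt => /orP[/eqP->|im].
      by rewrite (mf _ t3 _ u.+1) // leq_maxr.
    have := H2 i im; case e : (Ff _) => [//|[//|w]] _.
    by rewrite (mf _ t2 _ w.+1) // leq_maxl.
  exists (maxn v.+1 (maxn t1 t2)); apply/FP; split; first by lia.
    by apply: (mf _ t1) => //; lia.
  move=> i /e2; case e : (Ff _) => [//|[//|w]] _.
  by rewrite (mf _ t2 _ w.+1) //; lia.
Qed.

Lemma step_function_exists c k : exists F, step_function k c F.
Proof.
elim/code_nested_ind: c k => [k|k|i k|f gs IHf IHgs k|f g IHf IHg [|k]|f IHf k].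
- exists (fun=> 1); apply: (@step_function_total k CZero (fun=> 0)).
    exact: recursive_on_const.
  by move=> xs v _; split=> [H|<-]; [inversion H | constructor].
- eexists; apply: (@step_function_total k CSucc (fun xs => (nth 0 xs 0).+1)).
    by apply: recursive_on_succ; exact: recursive_on_proj.
  move=> xs v _; split=> [H|<-]; first by inversion H; rewrite nth0.
  by rewrite nth0; constructor.
- eexists; apply: (@step_function_total k (CProj i) (nth 0 ^~ i)).
    exact: recursive_on_proj.
  by move=> xs v _; split=> [H|<-]; [inversion H | constructor].
- have [Fs HFs] : exists Fs, step_functions k gs Fs.
    apply: step_functionsP.
    by elim: gs IHgs => [//|g gs IH /= [H Hs]]; split=> //; exact: IH.
  by have [Ff HFf] := IHf (size Fs); exact: step_function_comp HFf HFs.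
(* At arity zero [CRec] has nothing to recurse on and never halts. *)
- exists (fun=> 0); split=> [|//|[|//] v _]; first exact: recursive_on_const.
  by split=> [H|[]//]; inversion H.
- have [Ff HFf] := IHf k; have [Fg HFg] := IHg k.+2.
  exact: step_function_rec HFf HFg.
- by have [Ff HFf] := IHf k.+1; exact: step_function_mu HFf.
Qed.

(** Both evaluations are seen by the step function at the larger of their budgets, where it has a
    single value. *)
Lemma eval_functional c xs v v' : eval c xs v -> eval c xs v' -> v = v'.
Proof.
have [F [_ mF sF]] := step_function_exists c (size xs).
move=> /sF[//|t e] /sF[//|t' e'].
have := mF xs _ (maxn t t') v erefl (leq_maxl _ _) e.
by rewrite (mF xs _ (maxn t t') v' erefl (leq_maxr _ _) e') => -[].
Qed.

Lemma evals_functional gs xs vs vs' : evals gs xs vs -> evals gs xs vs' -> vs = vs'.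
Proof.
elim: gs vs vs' => [|g gs IH] vs vs' H H'; first by inversion H; inversion H'.
have [v [ws [-> ev evs]]] := evals_cons_inv H.
have [v' [ws' [-> ev' evs']]] := evals_cons_inv H'.
by rewrite (eval_functional ev ev') (IH _ _ evs evs').
Qed.

(** * Recursively enumerable predicates *)

Lemma re_pred4_exists F (P : nat -> nat -> nat -> nat -> Prop) :
  recursive_on 5 F ->
  (forall a b d x, P a b d x <-> exists z, F [:: z; a; b; d; x] = 0) ->
  re_pred4 P.
Proof.
move=> [c Hc] PF; exists (CMu c) => a b d x; rewrite PF; split=> [[z Fz]|[v H]].
  have ex : exists z, F [:: z; a; b; d; x] == 0 by exists z; apply/eqP.
  case: (ex_minnP ex) => n /eqP Fn nmin; exists n; constructor.
    by rewrite -Fn; exact: Hc.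
  move=> m mn; exists (F [:: m; a; b; d; x]).-1.
  rewrite prednK ?lt0n; first exact: Hc.
  by apply/negP => /nmin; rewrite leqNgt mn.
(* Since evaluation is functional, the number returned by the minimisation is a genuine zero of
   [F]. *)
have [H0 _] := eval_mu_inv H; exists v.
exact: eval_functional (Hc [:: v; a; b; d; x] erefl) H0.
Qed.

(** The inequality says that the rational [(a - b) / (d + 1)] is below [n], so this enumerates the
    superlevel sets of the uniform test built from a Martin-Löf test. A single number [z] bounds
    both [n] and the running time of the check. *)
Lemma re_pred4_union (P : nat -> nat -> Prop) :
  re_pred2 P ->
  re_pred4 (fun a b d x =>
    exists n, a < n * d.+1 + b /\ (n = 0 \/ P n.*2.+1 x)).
Proof.
move=> [c Pc]; have [E [rE mE sE]] := step_function_exists c 2.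
(* The list holds the candidate [n], the previous result, then [z], [a], [b], [d], [x]. The
   truncated difference vanishes exactly when [a < n * d.+1 + b]. *)
pose lhs ys := (nth 0 ys 3).+1 - (nth 0 ys 0 * (nth 0 ys 5).+1 + nth 0 ys 4).
pose run ys := E [seq K ys | K <- [:: nth 0 ^~ 2;
  fun ys => (nth 0 ys 0 + nth 0 ys 0).+1; nth 0 ^~ 6]].
pose g ys := if lhs ys == 0 then
    if nth 0 ys 0 == 0 then 0 else if run ys == 0 then nth 0 ys 1 else 0
  else nth 0 ys 1.
(* The result starts at [1] and drops to [0] for good once a suitable [n] below [z] is met. *)
pose F ys := primrec (fun=> 1) g (nth 0 ys 0) ys.
have FP z a b d x m : primrec (fun=> 1) g m [:: z; a; b; d; x] = 0 <->
    exists2 n, n < m & a < n * d.+1 + b /\ (n = 0 \/ E [:: z; n.*2.+1; x] != 0).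
  elim: m => [|m IH]; first by split=> // -[].
  rewrite primrecS {1}/g /lhs /run /= subn_eq0 addnn.
  split.
    case: ltnP => [lem|_] /=; last by case/IH => n nm Hn; exists n => //; exact: leqW.
    case: eqP => [m0 _|_]; first by exists m => //; split => //; left.
    case: eqP => [_ /IH[n nm Hn]|/eqP ne _]; first by exists n => //; exact: leqW.
    by exists m => //; split=> //; right.
  move=> [n]; rewrite ltnS leq_eqVlt => /orP[/eqP-> [-> H]|nm H].
    by case: eqP => // m0; case: H => [//|/negbTE->].
  have -> : primrec (fun=> 1) g m [:: z; a; b; d; x] = 0 by apply/IH; exists n.
  by case: ifP => // _; case: ifP => // _; case: ifP.
apply: (@re_pred4_exists F).
  apply: recursive_on_primrec; [exact: recursive_on_const| |exact: recursive_on_proj].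
  have proj := recursive_on_proj 7.
  apply: recursive_on_if.
  - apply: recursive_on_sub; first exact: recursive_on_succ.
    apply: recursive_on_add => //; apply: recursive_on_mul => //.
    exact: recursive_on_succ.
  - apply: recursive_on_if => //; first exact: recursive_on_const.
    apply: recursive_on_if => //; last exact: recursive_on_const.
    apply: recursive_on_comp => //; split=> //; split; last by split.
    by apply: recursive_on_succ; exact: recursive_on_add.
  - exact: proj.
move=> a b d x; split=> [[n [lt H]]|[z /FP[n _ [lt H]]]]; last first.
  exists n; split=> //; case: H => [->|/eqP H]; [by left | right].
  case e : (E _) H => [//|v] _; apply/Pc; exists v.
  by apply/sE => //; exists z.
case: H => [n0|/Pc[v /sE[//|t e]]].
  by exists n.+1; apply/FP; exists n => //; split=> //; left.
exists (maxn t n.+1); apply/FP; exists n; first by rewrite /=; lia.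
by split=> //; right; rewrite (mE _ t _ v) //; lia.
Qed.

(** The triple encodes the rational [2 ^ n], so the sets where a uniform test exceeds [2 ^ n] are
    enumerable uniformly in [n]. *)
Lemma re_pred2_exp2 (P : nat -> nat -> nat -> nat -> Prop) :
  re_pred4 P -> re_pred2 (fun n x => P (2 ^ n) 0 0 x).
Proof.
move=> [c Pc].
pose Gs : seq (seq nat -> nat) :=
  [:: fun xs => 2 ^ nth 0 xs 0; fun=> 0; fun=> 0; nth 0 ^~ 1].
have [gs Hgs] : exists gs, forall xs, size xs = 2 -> evals gs xs [seq G xs | G <- Gs].
  apply: all_recursive_on_evals; split.
    by apply: recursive_on_exp2; exact: recursive_on_proj.
  split; first exact: recursive_on_const.
  split; first exact: recursive_on_const.
  by split=> //; exact: recursive_on_proj.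
exists (CComp c gs) => n x; rewrite Pc; split=> -[v Hv]; exists v.
  by econstructor; first exact: Hgs.
have [vs Hvs] := eval_comp_inv Hv.
by rewrite (evals_functional Hvs (Hgs [:: n; x] erefl)).
Qed.

(** * Cylinders *)

Import Order.TTheory GRing.Theory Num.Theory.
Local Open Scope classical_set_scope.
Local Open Scope ring_scope.

Local Notation prefix := Defs.prefix.

Lemma omega_prefixS n (w : Omega) : prefix n.+1 w = rcons (prefix n w) (w n).
Proof. exact: mkseqS. Qed.

Lemma size_omega_prefix n (w : Omega) : size (prefix n w) = n.
Proof. exact: size_mkseq. Qed.

Lemma take_omega_prefix k n (w : Omega) : (k <= n)%N -> take k (prefix n w) = prefix k w.
Proof. by move=> kn; rewrite /prefix /mkseq -map_take take_iota (minn_idPl kn). Qed.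

Lemma cyl_rcons s b : cyl (rcons s b) = cyl s `&` [set w : Omega | w (size s) = b].
Proof.
apply/seteqP; split=> w; rewrite /cyl /= size_rcons omega_prefixS.
  by move/eqP; rewrite eqseq_rcons => /andP[/eqP-> /eqP->].
by move=> [-> ->].
Qed.

Lemma cyl_nil : cyl [::] = setT.
Proof. by apply/seteqP; split. Qed.

Lemma cyl_split s : cyl s = cyl (rcons s true) `|` cyl (rcons s false).
Proof.
rewrite !cyl_rcons -setIUr; apply/seteqP; split=> [w sw|w []//].
by split=> //=; case: (w _); [left | right].
Qed.

Lemma cyl_rcons_disj s : cyl (rcons s true) `&` cyl (rcons s false) = set0.
Proof. by rewrite !cyl_rcons -subset0 => w /= [[_ ->] []]. Qed.

(** Each next bit is decided by [b] from the bits so far. Both the descending path of a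
    supermartingale and the quantile map arise this way. *)
Fixpoint grow (b : seq bool -> bool) (n : nat) : seq bool :=
  if n is n'.+1 then rcons (grow b n') (b (grow b n')) else [::].

Definition path_of (b : seq bool -> bool) : Omega := fun i => b (grow b i).

Lemma prefix_path_of b n : prefix n (path_of b) = grow b n.
Proof. by elim: n => [//|n IH]; rewrite omega_prefixS IH. Qed.

Lemma cylE s (w : Omega) : cyl s w <-> prefix (size s) w = s.
Proof. by []. Qed.

Lemma open_cyl s : open (cyl s : set cantor_space).
Proof.
elim/last_ind: s => [|s b IH]; first by rewrite cyl_nil; exact: openT.
rewrite cyl_rcons; apply: openI => //.
have c : continuous ((fun w => w (size s)) : cantor_space -> bool).
  exact: (@proj_continuous nat (fun=> bool) (size s)).
exact: ((continuousP _).1 c [set b] (discrete_open _)).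
Qed.

Lemma cyls_bigcup (A : seq bool -> Prop) : cyls A = \bigcup_(s in A) cyl s.
Proof. by apply/seteqP; split=> [w [s [As ws]]|w [s As ws]]; exists s. Qed.

Lemma measurable_cyls (A : seq bool -> Prop) : measurable (cyls A : set Omega).
Proof.
apply: sub_sigma_algebra; rewrite cyls_bigcup; apply: bigcup_open => s _.
exact: open_cyl.
Qed.

Lemma measurable_cyl s : measurable (cyl s : set Omega).
Proof. by apply: sub_sigma_algebra; exact: open_cyl. Qed.

Lemma measurable_prefix_set (Q : seq bool -> Prop) n :
  measurable ([set w | Q (prefix n w)] : set Omega).
Proof.
rewrite (_ : [set w | _] = cyls (fun u => size u = n /\ Q u)).
  exact: measurable_cyls.
apply/seteqP; split=> w /=.
  by move=> Qw; exists (prefix n w); rewrite size_omega_prefix.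
by move=> [u [[<- Qu] ->]].
Qed.

(** The cylinders around [w] form a filter base, and each coordinate is constant on a long enough
    one; hence the filter converges to [w] in the product topology. *)
Lemma open_cyl_sub (U : set cantor_space) (w : Omega) :
  open U -> U w -> exists n, cyl (prefix n w) `<=` U.
Proof.
move=> oU Uw.
have : nbhs (w : cantor_space) U by apply: open_nbhs_nbhs.
pose F := filter_from [set: nat] (fun n => cyl (prefix n w)).
have FF : Filter F.
  apply: filter_from_filter; first by exists 0%N.
  move=> i j _ _; exists (maxn i j) => // v; rewrite !cylE !size_omega_prefix => e.
  split; apply/cylE; rewrite size_omega_prefix.
    by rewrite -(take_omega_prefix v (leq_maxl i j)) e take_omega_prefix // leq_maxl.
  by rewrite -(take_omega_prefix v (leq_maxr i j)) e take_omega_prefix // leq_maxr.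
suff cvF : F --> (w : cantor_space) by move/cvF => [n _ sub]; exists n.
apply/cvg_sup => i; apply/cvg_image; first by rewrite eqEsubset; split => // y _; exists (fun=> y).
move=> V /= nV; exists ((fun v : Omega => v i) @^-1` V); last first.
  by apply: image_preimage; rewrite eqEsubset; split => // y _; exists (fun=> y).
exists i.+1 => // v; rewrite cylE size_omega_prefix !omega_prefixS => /eqP.
by rewrite eqseq_rcons => /andP[_ /eqP e]; rewrite /preimage /= e; exact: nbhs_singleton.
Qed.

(** * Precise forecasts and supermartingales *)

Section CylinderProbability.
Variable R : realType.
Implicit Types (psi : seq bool -> R) (s : seq bool).

Lemma cyl_prob_nil psi : cyl_prob psi [::] = 1.
Proof. by rewrite /cyl_prob big_ord0. Qed.

Lemma cyl_prob_rcons psi s b :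
  cyl_prob psi (rcons s b) = cyl_prob psi s * (if b then psi s else 1 - psi s).
Proof.
rewrite /cyl_prob size_rcons big_ord_recr /=; congr (_ * _).
  apply: eq_bigr => k _; rewrite nth_rcons ltn_ord -cats1 takel_cat //.
  exact/ltnW.
by rewrite nth_rcons ltnn eqxx -cats1 take_size_cat.
Qed.

Lemma cyl_prob_ge0 psi s : (forall t, 0 <= psi t <= 1) -> 0 <= cyl_prob psi s.
Proof.
move=> psi01; elim/last_ind: s => [|s b IH]; first by rewrite cyl_prob_nil.
rewrite cyl_prob_rcons mulr_ge0 //; have := psi01 s.
by case: b => /andP[]; rewrite ?subr_ge0.
Qed.

(** The conditional expectation, given the prefix [s], of [f] at the prefix seen [n] steps later. *)
Fixpoint expect_steps psi (n : nat) (f : seq bool -> R) s : R :=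
  if n is n'.+1 then psi s * expect_steps psi n' f (rcons s true)
                     + (1 - psi s) * expect_steps psi n' f (rcons s false)
  else f s.

Definition hit_ind (Q : seq bool -> Prop) s : R := if `[< Q s >] then 1 else 0.

Lemma measure_expect_steps (mu : probability Omega R) psi (Q : seq bool -> Prop) n s :
  (forall t, mu (cyl t) = (cyl_prob psi t)%:E) ->
  mu (cyl s `&` [set w | Q (prefix (size s + n) w)]) =
  (cyl_prob psi s * expect_steps psi n (hit_ind Q) s)%:E.
Proof.
move=> mucyl.
have mQ m t : measurable (cyl t `&` [set w | Q (prefix m w)] : set Omega).
  by apply: measurableI; [exact: measurable_cyl | exact: measurable_prefix_set].
elim: n s => [|n IH] s /=.
  rewrite addn0 /hit_ind; case: asboolP => [Qs|nQs].
    rewrite mulr1 -mucyl; congr (mu _); apply/seteqP; split=> [w []//|w sw].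
    by split=> //=; rewrite sw.
  rewrite mulr0 (_ : _ `&` _ = set0) ?measure0 // -subset0 => w /= [-> //].
rewrite {1}cyl_split setIUl measureU; [|exact: mQ|exact: mQ|]; last first.
  by rewrite setIACA cyl_rcons_disj set0I.
have := IH (rcons s true); have := IH (rcons s false).
rewrite !size_rcons !addSn !addnS => e0 e1.
apply: etrans (f_equal2 (@adde R) e1 e0) _.
by congr EFin; rewrite !cyl_prob_rcons /=; lra.
Qed.

(** [cyls A] is the increasing union of the events that a prefix in [A] has occurred by time [n], so
    continuity from below applies. *)
Lemma measure_cyls_le (mu : probability Omega R) psi (A : seq bool -> Prop) (c : R) :
  (forall t, mu (cyl t) = (cyl_prob psi t)%:E) ->
  (forall n, expect_steps psi n
     (hit_ind (fun s => exists2 k, (k <= size s)%N & A (take k s))) [::] <= c) ->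
  (mu (cyls A) <= c%:E)%E.
Proof.
move=> mucyl le_c.
pose Q s := exists2 k, (k <= size s)%N & A (take k s).
pose G n : set Omega := [set w | Q (prefix n w)].
have GE n : mu (G n) = (expect_steps psi n (hit_ind Q) [::])%:E.
  have := measure_expect_steps Q n [::] mucyl.
  by rewrite cyl_nil setTI cyl_prob_nil mul1r.
have mG n : measurable (G n) by exact: measurable_prefix_set.
have UG : \bigcup_n G n = cyls A.
  apply/seteqP; split=> [w [n _ [k]]|w [s [As sw]]].
    rewrite size_omega_prefix => kn; rewrite take_omega_prefix // => Ak.
    by exists (prefix k w); rewrite size_omega_prefix.
  exists (size s) => //; exists (size s); first by rewrite size_omega_prefix.
  by rewrite take_omega_prefix // sw.
have ndG : {homo G : n m / (n <= m)%N >-> (n <= m)%O}.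
  move=> n m nm; apply/subsetPset => w [k]; rewrite size_omega_prefix => kn.
  rewrite take_omega_prefix // => Ak; exists k; first by rewrite size_omega_prefix (leq_trans kn).
  by rewrite take_omega_prefix // (leq_trans kn).
have mUG : measurable (\bigcup_n G n) by rewrite UG; exact: measurable_cyls.
have cv := @nondecreasing_cvg_mu _ _ _ mu _ mG mUG ndG.
rewrite -UG -(cvg_lim _ cv) //; apply: lime_le; first by apply/cvg_ex; eexists; exact: cv.
by apply: nearW => n /=; rewrite GE lee_fin.
Qed.

Lemma expect_steps_le psi n f (M : seq bool -> R) s :
  (forall t, 0 <= psi t <= 1) ->
  (forall t, f t <= M t) ->
  (forall t, psi t * M (rcons t true) + (1 - psi t) * M (rcons t false) <= M t) ->
  expect_steps psi n f s <= M s.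
Proof.
move=> psi01 fM superM; elim: n s => [//|n IH] s /=.
apply: le_trans (superM s); have /andP[p0 p1] := psi01 s.
by apply: lerD; apply: ler_wpM2l; rewrite ?subr_ge0.
Qed.

End CylinderProbability.

Section UpperExpectation.
Variable R : realType.
Implicit Types a b p c : R.

Lemma upper_exp_ub a b (f1 f0 : R) p : 0 <= a -> b <= 1 -> a <= p <= b ->
  p * f1 + (1 - p) * f0 <= upper_exp a b f1 f0.
Proof.
move=> a0 b1 pab; apply: ub_le_sup; last by exists p => //=; rewrite in_itv.
exists (`|f1| + `|f0|) => _ [q /= /[!in_itv] /= /andP[aq qb] <-].
have q0 : 0 <= q by exact: le_trans aq.
have q1 : 0 <= 1 - q by rewrite subr_ge0; exact: le_trans b1.
apply: lerD.
  apply: (le_trans (ler_wpM2l q0 (ler_norm f1))); rewrite ler_piMl //; lra.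
apply: (le_trans (ler_wpM2l q1 (ler_norm f0))); rewrite ler_piMl //; lra.
Qed.

Lemma upper_exp_le a b (f1 f0 : R) c : a <= b ->
  (forall p, a <= p <= b -> p * f1 + (1 - p) * f0 <= c) ->
  upper_exp a b f1 f0 <= c.
Proof.
move=> ab le_c; apply: ge_sup.
  by exists (a * f1 + (1 - a) * f0); exists a => //=; rewrite in_itv /= lexx.
by move=> _ [p /= /[!in_itv] /= /le_c le <-].
Qed.

End UpperExpectation.

Section Supermartingale.
Variables (R : realType) (phi : forecasting_system R).

Lemma supermartingale_step M s p : supermartingale phi M ->
  flo phi s <= p <= fhi phi s ->
  p * M (rcons s true) + (1 - p) * M (rcons s false) <= M s.
Proof.
move=> superM pI; apply: le_trans (superM s).
by have [? [_ ?]] := fs_interval phi s; exact: upper_exp_ub.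
Qed.

(* The path always moves to the child of smaller value. *)
Lemma supermartingale_descent M s : supermartingale phi M ->
  exists2 w : Omega, prefix (size s) w = s &
    forall n, (size s <= n)%N -> M (prefix n w) <= M s.
Proof.
move=> superM.
(* The path has to run through [s] first; the choice between children starts only there. *)
pose b t := if (size t < size s)%N then nth false s (size t)
            else M (rcons t true) <= M (rcons t false).
have szg n : size (grow b n) = n by elim: n => //= n IH; rewrite size_rcons IH.
have gs n : (n <= size s)%N -> grow b n = take n s.
  elim: n => [|n IH] ns; first by rewrite take0.
  by rewrite /= (IH (ltnW ns)) {1}/b (size_takel (ltnW ns)) ns (take_nth false ns).
exists (path_of b); first by rewrite prefix_path_of gs // take_size.
move=> n; rewrite prefix_path_of => /subnK <-; elim: (n - size s)%N => [|m IH].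
  by rewrite add0n gs // take_size.
apply: le_trans IH; rewrite addSn /=; set t := grow b _.
have -> : b t = (M (rcons t true) <= M (rcons t false)).
  by rewrite {1}/b szg ltnNge leq_addl.
have [lo0 [lohi hi1]] := fs_interval phi t.
(* One admissible forecast is enough: the weighted mean of the two children is at least the smaller
   of them. *)
have := @supermartingale_step M t (flo phi t) superM; rewrite lexx lohi => /(_ isT).
have := lo0; have := le_trans lohi hi1; move: (flo phi t) => p.
case: (leP (M (rcons t true)) (M (rcons t false))) => le p1 p0; apply: le_trans.
  have : p * M (rcons t true) + (1 - p) * M (rcons t true) = M (rcons t true) by lra.
  by move=> {1}<-; apply: lerD => //; apply: ler_wpM2l; rewrite ?subr_ge0.
have : p * M (rcons t false) + (1 - p) * M (rcons t false) = M (rcons t false) by lra.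
by move=> {1}<-; apply: lerD => //; apply: ler_wpM2l => //; exact: ltW.
Qed.

Lemma limn_einf_le (u : (\bar R)^nat) (c : \bar R) N :
  (forall n, (N <= n)%N -> (u n <= c)%E) -> (limn_einf u <= c)%E.
Proof.
move=> le_c; rewrite /limn_einf leeNl /limn_esup /limf_esup.
apply: le_ereal_inf_tmp => _ [V [m _ mV] <-].
apply: (@le_trans _ _ (- u (maxn N m))%E); first by rewrite leeN2 le_c // leq_maxl.
by apply: ereal_sup_ubound; exists (maxn N m) => //; apply: mV; exact: leq_maxr.
Qed.

Lemma limn_einf_ge (u : (\bar R)^nat) (c : \bar R) N :
  (forall n, (N <= n)%N -> (c <= u n)%E) -> (c <= limn_einf u)%E.
Proof.
move=> ge_c; rewrite /limn_einf leeNr /limn_esup /limf_esup.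
apply: (@le_trans _ _ (ereal_sup ((fun n => - u n)%E @` [set n | (N <= n)%N]))).
  by apply: ereal_inf_lbound; exists [set n | (N <= n)%N] => //; exists N.
by apply: ge_ereal_sup => _ [n /= Nn <-]; rewrite leeN2 ge_c.
Qed.

Lemma measure_le_upper_prob (mu : probability Omega R) (A : seq bool -> Prop) :
  M_class phi mu -> (mu (cyls A) <= upper_prob phi (cyls A))%E.
Proof.
move=> [psi [psiI mucyl]]; apply: le_ereal_inf_tmp => _ [M [superM infM] <-].
(* If [M] eventually stays at or below [M s] along [w], then so does its lower limit, which
   dominates the indicator. *)
have ge_ind s (w : Omega) : prefix (size s) w = s ->
    (forall n, (size s <= n)%N -> M (prefix n w) <= M s) -> \1_(cyls A) w <= M s.
  move=> _ desc; rewrite -lee_fin; apply: le_trans (infM w) _.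
  by apply: (@limn_einf_le _ _ (size s)) => n sn; rewrite lee_fin desc.
apply: (measure_cyls_le mucyl) => n; apply: expect_steps_le => t.
- have [lo0 [_ hi1]] := fs_interval phi t; have /andP[lo hi] := psiI t.
  by rewrite (le_trans lo0) //= (le_trans hi).
(* The descending path through [t] lies in [cyls A] as soon as [t] has a prefix in [A], which forces
   [M t] to be at least [1]; in all cases [M t] is nonnegative. *)
- have [w wt desc] := supermartingale_descent t superM.
  apply: le_trans (ge_ind t w wt desc); rewrite /hit_ind.
  case: asboolP => [[k kt Ak]|_]; last by rewrite indicE.
  rewrite indicE mem_set // ; exists (take k t); split=> //.
  by rewrite size_takel // -(take_omega_prefix _ kt) wt.
- exact: supermartingale_step.
Qed.

End Supermartingale.

(** * The measure of a precise forecasting system *)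

Section MeasureOfForecasts.
Variables (R : realType) (psi : seq bool -> R).
Hypothesis psi01 : forall s, 0 <= psi s <= 1.

(* The cylinder of [s] corresponds to the interval of length [cyl_prob psi s]
   with this left endpoint. *)
Let left_end (s : seq bool) : R :=
  \sum_(k < size s | nth false s k) cyl_prob psi (rcons (take k s) false).

Let left_end_rcons s b : left_end (rcons s b) =
  left_end s + (if b then cyl_prob psi (rcons s false) else 0).
Proof.
have take_rcons k : (k <= size s)%N -> take k (rcons s b) = take k s.
  by move=> ks; rewrite -cats1 takel_cat.
rewrite /left_end size_rcons big_mkcond big_ord_recr /= [in RHS]big_mkcond.
congr (_ + _); last by rewrite nth_rcons ltnn eqxx take_rcons // take_size.
by apply: eq_bigr => k _; rewrite nth_rcons ltn_ord take_rcons // ltnW.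
Qed.

Let bit (x : R) (s : seq bool) : bool := left_end (rcons s true) <= x.

(** Follows [x] through the nested intervals, the child [false] taking the left part. The required
    measure is the image of the uniform law under this map. *)
Let quantile (x : measurableTypeR R) : Omega := path_of (bit x).

Let cyl_prob_split s :
  cyl_prob psi s = cyl_prob psi (rcons s true) + cyl_prob psi (rcons s false).
Proof. by rewrite !cyl_prob_rcons /=; lra. Qed.

Let left_end_bounds s : 0 <= left_end s /\ left_end s + cyl_prob psi s <= 1.
Proof.
elim/last_ind: s => [|s b IH].
  by rewrite /left_end big_ord0 cyl_prob_nil add0r.
move: IH; rewrite cyl_prob_split left_end_rcons.
have := cyl_prob_ge0 (rcons s true) psi01.
have := cyl_prob_ge0 (rcons s false) psi01.
by case: b => p0 p1 [l0 l1]; split; lra.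
Qed.

(** With [sub_quantile] this squeezes the preimage of a cylinder between a half-open and a closed
    interval of the same length, so the fate of the endpoints need not be decided. *)
Let quantile_sub s (x : R) : 0 <= x <= 1 -> cyl s (quantile x) ->
  left_end s <= x <= left_end s + cyl_prob psi s.
Proof.
move=> x01; rewrite cylE prefix_path_of; elim/last_ind: s => [_|s b IH].
  by rewrite /left_end big_ord0 cyl_prob_nil add0r.
rewrite size_rcons /= => /eqP; rewrite eqseq_rcons => /andP[/eqP e /eqP].
move: (IH e); rewrite e /bit !left_end_rcons cyl_prob_split.
have := cyl_prob_ge0 (rcons s true) psi01.
have := cyl_prob_ge0 (rcons s false) psi01.
case: b; first by move=> *; lra.
by move=> + + + /negbT; rewrite -ltNge => *; lra.
Qed.

Let sub_quantile s (x : R) : left_end s <= x < left_end s + cyl_prob psi s ->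
  cyl s (quantile x).
Proof.
rewrite cylE prefix_path_of; elim/last_ind: s => [//|s b IH].
rewrite size_rcons left_end_rcons /= => xI.
have p1 := cyl_prob_ge0 (rcons s true) psi01.
have p0 := cyl_prob_ge0 (rcons s false) psi01.
have sp := cyl_prob_split s.
rewrite IH; last by case: b xI => xI; lra.
congr rcons; rewrite /bit left_end_rcons /=.
case: b xI => xI; first by apply/idP; lra.
by apply/negbTE; rewrite -ltNge; lra.
Qed.

Let measurable_quantile_cyl s : measurable (quantile @^-1` cyl s).
Proof.
elim/last_ind: s => [|s b IH]; first by rewrite cyl_nil preimage_setT.
have -> : quantile @^-1` cyl (rcons s b) = quantile @^-1` cyl s `&`
    [set` if b then `[left_end (rcons s true), +oo[ else `]-oo, left_end (rcons s true)[].
  rewrite cyl_rcons; apply/seteqP; split=> x; rewrite /preimage /=.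
    move=> [sx bx]; split=> //; move: bx; rewrite /quantile /path_of.
    move: (sx); rewrite cylE prefix_path_of => ->; rewrite /bit.
    case: b => [le|/negbT]; first by rewrite /= in_itv /= andbT.
    by rewrite -ltNge /= in_itv /=.
  move=> [sx bx]; split=> //; rewrite /quantile /path_of.
  move: (sx); rewrite cylE prefix_path_of => ->; rewrite /bit.
  case: b bx => /=; rewrite in_itv /= ?andbT //.
  by rewrite ltNge => /negbTE.
by apply: measurableI => //; exact: measurable_itv.
Qed.

Let measurable_quantile : measurable_fun setT quantile.
Proof.
apply: (@measurability _ _ (measurableTypeR R) Omega setT quantile
  (@open cantor_space) erefl).
move=> _ [U oU <-]; rewrite setTI.
(* An open set is a union of cylinders, and there are only countably many strings. *)
have -> : U = \bigcup_(s in [set s | cyl s `<=` U]) cyl s.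
  apply/seteqP; split=> [w Uw|w [s sU /sU//]].
  have [n sub] := open_cyl_sub oU Uw; exists (prefix n w) => //=.
  by rewrite cylE size_omega_prefix.
rewrite preimage_bigcup bigcup_mkcond; apply: countable_bigcupT_measurable.
  exact: countableP.
by move=> s; case: ifP => // _; exact: measurable_quantile_cyl.
Qed.

Lemma forecast_measure_exists :
  exists mu : probability Omega R, forall s, mu (cyl s) = (cyl_prob psi s)%:E.
Proof.
pose X : {mfun measurableTypeR R >-> Omega} :=
  HB.pack quantile (isMeasurableFun.Build _ _ _ _ quantile measurable_quantile).
exists (distribution (uniform_prob (@ltr01 R)) X) => s.
rewrite /distribution /pushforward /=.
set U := quantile @^-1` _.
have mU : measurable U by exact: measurable_quantile_cyl.
have mU1 : measurable (U `&` `[0, 1]) by apply: measurableI.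
have -> : uniform_prob (@ltr01 R) U = lebesgue_measure (U `&` `[0, 1]).
  rewrite /uniform_prob integral_uniform_pdf.
  rewrite (eq_integral (fun=> 1%:E)).
    by rewrite integral_cst // mul1e.
  move=> x; rewrite inE /= in_itv /= => -[_ x01].
  by rewrite /uniform_pdf x01 subr0 invr1.
have p0 := cyl_prob_ge0 s psi01.
(* [b] selects the half-open or the closed interval; the second case below is that of length
   zero. *)
have itv_le (b : bool) : lebesgue_measure
    [set` Interval (BLeft (left_end s)) (BSide b (left_end s + cyl_prob psi s))]
    = (cyl_prob psi s)%:E.
  rewrite lebesgue_measure_itv /= lte_fin; case: ltP => [_|le].
    by rewrite -EFinB addrAC subrr add0r.
  by congr EFin; lra.
apply/eqP; rewrite eq_le; apply/andP; split.
  rewrite -(itv_le false); apply: le_measure; rewrite ?inE //.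
  move=> x [Ux] /=; rewrite !in_itv /= => x01; exact: quantile_sub.
rewrite -(itv_le true); apply: le_measure; rewrite ?inE //.
move=> x /=; rewrite !in_itv /= => xI; split; first exact: sub_quantile.
by have [l0 l1] := left_end_bounds s; lra.
Qed.

End MeasureOfForecasts.

(** * Attainment of the upper probability *)

Section UpperValue.
Variables (R : realType) (phi : forecasting_system R) (A : seq bool -> Prop).

Let hit s := exists2 k, (k <= size s)%N & A (take k s).

Let mean (f : seq bool -> R) (s : seq bool) (p : R) : R :=
  p * f (rcons s true) + (1 - p) * f (rcons s false).

(* The largest probability, over all precise forecasts compatible with [phi],
   that a prefix in [A] is seen within the next [m] steps after [s]. *)
Fixpoint upper_value (m : nat) (s : seq bool) : R :=
  if m is m'.+1 then
    Num.max (mean (upper_value m') s (flo phi s)) (mean (upper_value m') s (fhi phi s))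
  else hit_ind R hit s.

(** The mean is affine in [p], so it is largest at an endpoint: the lower one if the child [false]
    has the larger value, the upper one otherwise. *)
Let upper_value_step m s p : flo phi s <= p <= fhi phi s ->
  mean (upper_value m) s p <= upper_value m.+1 s.
Proof.
move=> /andP[lop phi_]; rewrite /= le_max /mean.
move: (upper_value m (rcons s true)) (upper_value m (rcons s false)) => x y.
case: (leP x y) => xy; apply/orP; [left | right].
  have H : (p - flo phi s) * (x - y) <= 0 by rewrite mulr_ge0_le0; lra.
  lra.
have H : 0 <= (fhi phi s - p) * (x - y) by rewrite mulr_ge0; lra.
lra.
Qed.

Let mean_le (f g : seq bool -> R) s p : 0 <= p <= 1 ->
  (forall b, f (rcons s b) <= g (rcons s b)) -> mean f s p <= mean g s p.
Proof.
by move=> /andP[p0 p1] fg; apply: lerD; apply: ler_wpM2l; rewrite ?subr_ge0.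
Qed.

Let lo01 s : 0 <= flo phi s <= 1.
Proof. by have [? [? ?]] := fs_interval phi s; lra. Qed.

Let hi01 s : 0 <= fhi phi s <= 1.
Proof. by have [? [? ?]] := fs_interval phi s; lra. Qed.

Let upper_value_ge0 m s : 0 <= upper_value m s.
Proof.
elim: m s => [|m IH] s /=; first by rewrite /hit_ind; case: ifP.
have := lo01 s => /andP[p0 p1]; rewrite le_max; apply/orP; left.
by rewrite addr_ge0 // mulr_ge0 // subr_ge0.
Qed.

Let upper_value_le1 m s : upper_value m s <= 1.
Proof.
elim: m s => [|m IH] s /=; first by rewrite /hit_ind; case: ifP.
have le1 p : 0 <= p <= 1 -> mean (upper_value m) s p <= 1.
  move=> p01; apply: le_trans (mean_le p01 (g := fun=> 1) _) _ => //.
  by rewrite /mean; lra.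
by rewrite ge_max !le1.
Qed.

Let upper_value_nd m s : upper_value m s <= upper_value m.+1 s.
Proof.
elim: m s => [|m IH] s; last first.
  have [lo0 [lohi hi1]] := fs_interval phi s.
  have st p : flo phi s <= p <= fhi phi s ->
      mean (upper_value m) s p <= upper_value m.+2 s.
    move=> pI; apply: le_trans (upper_value_step m.+1 pI).
    by apply: mean_le => //; lra.
  by rewrite [leLHS]/= ge_max !st // lexx lohi.
(* Base case: a hit is inherited by both children, so the value stays [1]; without a hit it starts
   from [0]. *)
have [hs|nhs] := pselect (hit s); last first.
  by rewrite {1}/upper_value /hit_ind asboolF.
have one b : upper_value 0 (rcons s b) = 1.
  rewrite /= /hit_ind asboolT //; have [k ks Ak] := hs; exists k.
    by rewrite size_rcons leqW.
  by rewrite -cats1 takel_cat.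
rewrite [leLHS]/= /hit_ind asboolT //.
have [lo0 [lohi hi1]] := fs_interval phi s.
have lo_lo : flo phi s <= flo phi s <= fhi phi s by rewrite lexx lohi.
by have := upper_value_step 0 lo_lo; rewrite /mean !one => ?; lra.
Qed.

Let has_sup_value s : has_sup (range (upper_value ^~ s)).
Proof.
split; first by exists (upper_value 0 s); exists 0%N.
by exists 1 => _ [m _ <-]; exact: upper_value_le1.
Qed.

Let limit_value s : R := sup (range (upper_value ^~ s)).

Let upper_value_le_limit m s : upper_value m s <= limit_value s.
Proof. by apply: ub_le_sup; [have [] := has_sup_value s | exists m]. Qed.

Let upper_value_homo s : {homo upper_value ^~ s : m n / (m <= n)%N >-> m <= n}.
Proof. by apply: homo_leq => [|m|m]; [exact: lexx | exact: le_trans | exact: upper_value_nd]. Qed.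

(** By monotonicity in the horizon, one finite stage is within [e] of the limit at both children,
    and one backward step from that stage stays below the limit at [s]. *)
Let supermartingale_limit : supermartingale phi limit_value.
Proof.
move=> s; have [lo0 [lohi hi1]] := fs_interval phi s.
apply: upper_exp_le => // p pI; apply/ler_addgt0Pr => e e0.
have [_ [m1 _ <-] H1] := sup_adherent e0 (has_sup_value (rcons s true)).
have [_ [m0 _ <-] H0] := sup_adherent e0 (has_sup_value (rcons s false)).
rewrite -!/(limit_value _) in H1 H0.
pose m := maxn m1 m0.
have le1 : limit_value (rcons s true) <= upper_value m (rcons s true) + e.
  have := upper_value_homo (rcons s true) (leq_maxl m1 m0); rewrite -/m => ?; lra.
have le0 : limit_value (rcons s false) <= upper_value m (rcons s false) + e.
  have := upper_value_homo (rcons s false) (leq_maxr m1 m0); rewrite -/m => ?; lra.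
have := le_trans (upper_value_step m pI) (upper_value_le_limit m.+1 s).
have p01 : 0 <= p <= 1 by lra.
have le b : limit_value (rcons s b) <= upper_value m (rcons s b) + e by case: b.
have := @mean_le limit_value (fun t => upper_value m t + e) s p p01 le.
by rewrite /mean => *; lra.
Qed.

(** Here [m] is the horizon and [m - (size s).+1] the number of steps left after the next one.
    Beyond the horizon the subtraction truncates, and the choice is still an endpoint of the
    forecast interval. *)
Let optimal (m : nat) (s : seq bool) : R :=
  let f := mean (upper_value (m - (size s).+1)) s in
  if f (flo phi s) <= f (fhi phi s) then fhi phi s else flo phi s.

Let optimal_expect m j s : (size s + j)%N = m ->
  expect_steps (optimal m) j (hit_ind R hit) s = upper_value j s.
Proof.
elim: j s => [//|j IH] s sj /=.
rewrite !IH ?size_rcons ?addSnnS // -/(mean _ s (optimal m s)) /optimal.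
have -> : (m - (size s).+1)%N = j by rewrite -sj addnS -addSn addKn.
by case: leP.
Qed.

Lemma upper_prob_le (c : R) :
  (forall mu, M_class phi mu -> (mu (cyls A) <= c%:E)%E) ->
  (upper_prob phi (cyls A) <= c%:E)%E.
Proof.
move=> le_c; apply: (@le_trans _ _ (limit_value [::])%:E).
  apply: ereal_inf_lbound; exists limit_value => //; split=> // w.
  have [[s [As sw]]|nw] := pselect (cyls A w); last first.
    rewrite indicE memNset //; apply: (@limn_einf_ge _ _ _ 0) => n _.
    by rewrite lee_fin; exact: le_trans (upper_value_ge0 0 _) (upper_value_le_limit _ _).
  apply: (@limn_einf_ge _ _ _ (size s)) => n sn; rewrite lee_fin.
  apply: le_trans (upper_value_le_limit 0 _); rewrite /= /hit_ind asboolT.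
    by rewrite indicE; case: (_ \in _).
  exists (size s); first by rewrite size_omega_prefix.
  by rewrite take_omega_prefix // sw.
(* Each finite stage is the probability, under the measure of [optimal m], of a hit by time [m],
   hence at most [c]. *)
rewrite lee_fin; apply: ge_sup => [|_ [m _ <-]].
  by exists (upper_value 0 [::]); exists 0%N.
have oI s : flo phi s <= optimal m s <= fhi phi s.
  have [_ [lohi _]] := fs_interval phi s.
  by rewrite /optimal; case: ifP => _; rewrite lexx lohi.
have [mu mucyl] : exists mu : probability Omega R,
    forall s, mu (cyl s) = (cyl_prob (optimal m) s)%:E.
  apply: forecast_measure_exists => s; have := oI s; have := lo01 s; have := hi01 s.
  by move=> *; lra.
rewrite -lee_fin -(@optimal_expect m m [::]) //.
have := measure_expect_steps hit m [::] mucyl.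
rewrite cyl_nil setTI cyl_prob_nil mul1r => <-.
apply: le_trans (le_c mu _); last by exists (optimal m).
apply: le_measure; rewrite ?inE.
- exact: measurable_prefix_set.
- exact: measurable_cyls.
move=> w [k]; rewrite size_omega_prefix => km.
by rewrite take_omega_prefix // => Ak; exists (prefix k w); rewrite size_omega_prefix.
Qed.

End UpperValue.

(** * Tests *)

Section Tests.
Variable R : realType.

(** A superlevel set at a real [x] is the union of those at the rationals above [x], hence again a
    union of cylinders. *)
Lemma measurable_cyls_superlevel (tau : Omega -> \bar R) (B : rat -> seq bool -> Prop) :
  (forall (r : rat) w, ((ratr r)%:E < tau w)%E <-> cyls (B r) w) ->
  measurable_fun setT tau.
Proof.
move=> tauB; apply: (measurability _ (ErealGenOInfty.measurableE R)) => _ [_ [x ->] <-].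
rewrite setTI.
rewrite (_ : _ @^-1` _ = cyls (fun s => exists2 q : rat, x < ratr q & B q s)).
  exact: measurable_cyls.
apply/seteqP; split=> w; rewrite /preimage /=.
  rewrite in_itv /= andbT => xtau.
  have [q xq qtau] : exists2 q : rat, x < ratr q & ((ratr q)%:E < tau w)%E.
    case: (tau w) xtau => [y|_|//].
      rewrite lte_fin => /rat_in_itvoo[q]; rewrite in_itv /= => /andP[xq qy].
      by exists q; rewrite ?lte_fin.
    have /rat_in_itvoo[q] : x < x + 1 by rewrite ltrDl.
    by rewrite in_itv /= => /andP[xq _]; exists q; rewrite ?ltry.
  by have [s [Bs sw]] := (tauB q w).1 qtau; exists s; split=> //; exists q.
move=> [s [[q xq Bs] sw]]; rewrite in_itv /= andbT.
by apply: lt_trans ((tauB q w).2 _); [rewrite lte_fin | exists s].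
Qed.

(** Markov's inequality. *)
Lemma superlevel_measure_le (mu : probability Omega R) (tau : Omega -> \bar R)
    (G : set Omega) (a : R) :
  (forall w, (0 <= tau w)%E) -> measurable_fun setT tau -> measurable G ->
  0 < a -> (forall w, G w -> (a%:E <= tau w)%E) ->
  (\int[mu]_w tau w <= 1)%E -> (mu G <= (a^-1)%:E)%E.
Proof.
move=> tau0 mtau mG a0 atau le1.
have : (a%:E * mu G <= 1)%E.
  apply: le_trans le1; apply: (@le_trans _ _ (\int[mu]_(w in G) tau w)%E); last first.
    by apply: ge0_subset_integral.
  rewrite -integral_cst //; apply: ge0_le_integral => //.
  - by move=> w _ /=; rewrite lee_fin ltW.
  - exact: measurable_funS mtau.
by move=> H; rewrite -[leRHS]mule1 -lee_pdivrMl // ?invr_gt0 // invrK.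
Qed.

Lemma rat_of_lt_nat a b d n : (rat_of a b d < n%:R) = (a < n * d.+1 + b)%N.
Proof.
rewrite /rat_of ltr_pdivrMr ?ltr0z // ltrBlDr -[d.+1%:Q]pmulrn -[a%:Q]pmulrn.
by rewrite -[b%:Q]pmulrn -natrM -natrD ltr_nat.
Qed.

Lemma ML_test_of_unif_test (phi : forecasting_system R) tau B :
  (forall w, (0 <= tau w)%E) -> re_setQ B ->
  (forall (r : rat) w, ((ratr r)%:E < tau w)%E <-> cyls (B r) w) ->
  (forall mu, M_class phi mu -> (\int[mu]_w tau w <= 1)%E) ->
  ML_test phi (fun n => B (rat_of (2 ^ n) 0 0)).
Proof.
move=> tau0 [P [reP BP]] tauB int1; split.
  by exists (fun n x => P (2 ^ n)%N 0%N 0%N x); split; [exact: re_pred2_exp2 | move=> n s].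
move=> n; apply: upper_prob_le => mu /int1.
apply: (@superlevel_measure_le _ tau _ (2 ^+ n)) => //.
- exact: measurable_cyls_superlevel tauB.
- exact: measurable_cyls.
move=> w /tauB /ltW; rewrite (_ : ratr _ = 2 ^+ n) //.
by rewrite /rat_of subr0 divr1 -[(2 ^ n)%N%:Q]pmulrn ratr_nat natrX.
Qed.

Lemma unif_test_of_ML_test (phi : forecasting_system R) A :
  ML_test phi A ->
  unif_test (M_class phi) (fun w : Omega => ereal_sup [set (n%:R%:E : \bar R) | n in
    [set n | n = 0%N \/ cyls (A n.*2.+1) w]]).
Proof.
move=> [[P [reP AP]] upA]; set tau := fun w => _.
have tau0 w : (0 <= tau w)%E by apply: ereal_sup_ubound; exists 0%N => //; left.
pose B (r : rat) s := exists n, r < n%:R /\ (n = 0%N \/ A n.*2.+1 s).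
have tauB (r : rat) w : ((ratr r)%:E < tau w)%E <-> cyls (B r) w.
  split=> [/ereal_sup_gt[_ [n Hn <-]]|[s [[n [rn Hn]] sw]]].
    rewrite lte_fin -(ratr_nat R) ltr_rat => rn.
    case: Hn => [n0|[s [As sw]]]; last first.
      by exists s; split=> //; exists n; split=> //; right.
    (* Here [r] is negative, and the empty string covers all paths. *)
    by exists [::]; split=> //; exists n; split=> //; left.
  apply: (@lt_le_trans _ _ (n%:R)%:E); first by rewrite lte_fin -(ratr_nat R) ltr_rat.
  apply: ereal_sup_ubound; exists n => //=; case: Hn => [n0|As]; [by left | right].
  by exists s.
split=> //; split.
  exists B; split=> //.
  exists (fun a b d x => exists n, (a < n * d.+1 + b)%N /\ (n = 0%N \/ P n.*2.+1 x)).
  split; first exact: re_pred4_union.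
  move=> a b d s; split=> -[n [ltn Hn]]; exists n.
    by rewrite rat_of_lt_nat in ltn; split=> //; case: Hn => [|/AP]; [left | right].
  by rewrite rat_of_lt_nat; split=> //; case: Hn => [|/AP]; [left | right].
move=> mu Cmu.
pose G n := cyls (A n.*2.+1).
have mG n : measurable (G n : set Omega) by exact: measurable_cyls.
pose f n (w : Omega) : \bar R := (n%:R * \1_(G n) w)%:E.
have f0 n w : (0 <= f n w)%E by rewrite lee_fin mulr_ge0 // indicE.
have mf n : measurable_fun setT (f n).
  apply/measurable_EFinP; apply: measurable_funM => //.
(* A supremum of nonnegative terms is at most their sum, which can be integrated termwise. *)
have le_tau w : (tau w <= \sum_(n <oo) f n w)%E.
  apply: ge_ereal_sup => _ [n [->|Gw] <-]; first by apply: nneseries_ge0 => k *; exact: f0.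
  apply: (@le_trans _ _ (f n w)); first by rewrite /f indicE mem_set // mulr1.
  rewrite (@nneseriesD1 _ _ n) //.
  by apply: leeDl; apply: nneseries_ge0 => k *; exact: f0.
apply: (@le_trans _ _ (\int[mu]_w \sum_(n <oo) f n w)%E).
  apply: ge0_le_integral => //.
  - exact: measurable_cyls_superlevel tauB.
  - exact: ge0_emeasurable_sum.
(* The comparison series has terms [1 / 2 ^ n.+1] and total at most [1]. *)
rewrite integral_nneseries //; apply: le_trans (@epsilon_trick0 R 1 xpredT ler01).
apply: lee_nneseries => n *; first by apply: integral_ge0 => w _; exact: f0.
have -> : (\int[mu]_w f n w = n%:R%:E * mu (G n))%E.
  rewrite /f; under eq_integral do rewrite EFinM.
  rewrite ge0_integralZl //; last exact/measurable_EFinP.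
  by congr (_ * _)%E; rewrite (integral_indic mu measurableT (mG n)) setIT.
have le_mu : (mu (G n) <= (2%:R ^- n.*2.+1)%:E)%E.
  exact: le_trans (measure_le_upper_prob _ Cmu) (upA _).
apply: le_trans (lee_wpmul2l _ le_mu) _; first by rewrite lee_fin.
rewrite -EFinM lee_fin mul1r natrX ler_pdivrMr ?exprn_gt0 //.
(* Splitting the exponent reduces the bound to [n <= 2 ^ n]; this is why the levels of odd index
   [2n + 1] are used. *)
have -> : n.*2.+1 = (n.+1 + n)%N by rewrite -addnn addSn.
rewrite exprD mulKf ?expf_neq0 ?pnatr_eq0 //.
by rewrite -natrX ler_nat ltnW // ltn_expl.
Qed.

End Tests.

Theorem theorem7p3 (R : realType) (phi : forecasting_system R) (w : Omega) :
  computable_fs phi ->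
  (ML_random phi w <-> unif_random (M_class phi) w).
Proof.
move=> _; split=> [rnd tau [tau0 [[B [reB tauB]] int1]]|rnd A testA wA].
  rewrite lt_neqAle leey andbT; apply/eqP => tauw.
  apply: (rnd _ (ML_test_of_unif_test tau0 reB tauB int1)) => n.
  by apply/tauB; rewrite tauw ltry.
have := rnd _ (unif_test_of_ML_test testA).
rewrite ltNge => /negP; apply; rewrite leye_eq; apply/eqP.
(* A path in every level makes all natural numbers members of the set whose supremum is the test
   value. *)
apply: eq_infty => r.
apply: (@le_trans _ _ ((Num.bound `|r|)%:R)%:E).
  by rewrite lee_fin ltW // (le_lt_trans (ler_norm r)) // archi_boundP.
by apply: ereal_sup_ubound; exists (Num.bound `|r|) => //; right.
Qed.
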